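(* Let $\kappa\ge\omega$ be a cardinal and let $\mathcal{U}$ be a (non-principal) ultrafilter on $\omega$ in the ground model $V$. If $\mathcal{U}$ is a P-point, then $\Vdash_{\mathbb{M}_\kappa}$ ``$\dot{\mu}_\mathcal{U}$ is a P-measure''.
   Context: $\lambda_\kappa$ is the standard product probability measure on $2^\kappa$, $\mathcal{N}_\kappa$ the ideal of $\lambda_\kappa$-null Borel sets, and $\mathbb{M}_\kappa=\mathrm{Bor}(2^\kappa)/\mathcal{N}_\kappa$ the measure algebra (with the induced measure, also denoted $\lambda_\kappa$); forcing with $\mathbb{M}_\kappa$ means forcing with $(\mathbb{M}_\kappa\setminus\{0\},\le)$. For $M\in\mathbb{M}_\kappa^\omega$ let $\dot M=\{\langle k,M(k)\rangle: k\in\omega\}$, an $\mathbb{M}_\kappa$-name for a subset of $\omega$; every $\mathbb{M}_\kappa$-name for a subset of $\omega$ is forced to equal such a $\dot M$ (with $M(k)=\llbracket k\in\dot N\rrbracket$). Let $\dot r$ be the name for the generic element of $2^\kappa$ (so $\llbracket \dot r(\alpha)=i\rrbracket=\{x\in 2^\kappa: x(\alpha)=i\}$). For a ground-model non-principal ultrafilter $\mathcal{U}$ and $M\in\mathbb{M}_\kappa^\omega$ define the Borel measure $\mu_M(B)=\lim_{k\to\mathcal{U}}\lambda_\kappa(M(k)\wedge B)$ on $2^\kappa$; it is $\sigma$-additive and absolutely continuous w.r.t. $\lambda_\kappa$, with Radon–Nikodym derivative $f_M$. The Solovay measure name $\dot\mu_\mathcal{U}$ is the $\mathbb{M}_\kappa$-name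 for a function $\wp(\omega)\to[0,1]$ with $\Vdash\dot\mu_\mathcal{U}(\dot M)=f_M(\dot r)$ for every $M\in\mathbb{M}_\kappa^\omega$; it is forced to be a finitely additive probability measure on $\omega$. A finitely additive probability measure $\mu$ on $\omega$ is a P-measure if it vanishes on singletons and for every decreasing sequence $(E_n)$ of infinite subsets of $\omega$ there is $E\subseteq\omega$ with $E\setminus E_n$ finite for all $n$ and $\mu(E)=\lim_n\mu(E_n)$. A P-point is a non-principal ultrafilter $\mathcal{U}$ such that every countable subfamily of $\mathcal{U}$ has a pseudointersection in $\mathcal{U}$. *)

(* Defs.v *)
From HB Require Import structures.
From mathcomp Require Import all_boot all_order all_algebra.
From mathcomp Require Import finmap generic_quotient.
From mathcomp Require Import all_classical all_reals all_analysis.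
From mathcomp Require Import measurable_realfun.

Set Implicit Arguments.
Unset Strict Implicit.
Unset Printing Implicit Defensive.

Import Order.TTheory GRing.Theory Num.Theory.
Import numFieldNormedType.Exports.

Local Open Scope classical_set_scope.
Local Open Scope ring_scope.

Fact malg_display : Order.disp_t. Proof. exact: Order.Disp tt tt. Qed.

Section MeasureAlgebra.
Context d (T : measurableType d) (R : realType) (P : probability T R).

Definition msets : Type := set_type (@measurable d T).
HB.instance Definition _ := Choice.on msets.

Definition eq_null (A B : msets) : bool :=
  `[< P ((val A `\` val B) `|` (val B `\` val A)) = 0%E >].

Lemma measurable_msets (A : msets) : measurable (val A).
Proof. exact: set_valP. Qed.

Definition le_null (A B : msets) : bool := `[< P (val A `\` val B) = 0%E >].

Lemma le_null_trans : transitive le_null.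
Proof.
move=> B A C /asboolP AB /asboolP BC; apply/asboolP.
have mA := measurable_msets A; have mB := measurable_msets B.
have mC := measurable_msets C.
have mAB : measurable (val A `\` val B) by exact: measurableD.
have mBC : measurable (val B `\` val C) by exact: measurableD.
apply: (subset_measure0 _ (measurableU _ _ mAB mBC)).
- exact: measurableD.
- by move=> x [Ax Cx]; have [Bx|Bx] := pselect (val B x); [right|left].
- exact: null_set_setU.
Qed.

Lemma eq_nullE (A B : msets) : eq_null A B = le_null A B && le_null B A.
Proof.
have mA := measurable_msets A; have mB := measurable_msets B.
have mAB : measurable (val A `\` val B) by exact: measurableD.
have mBA : measurable (val B `\` val A) by exact: measurableD.
apply/asboolP/andP => [AB0|[/asboolP AB0 /asboolP BA0]].
  have mU := measurableU _ _ mAB mBA.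
  split; apply/asboolP.
    by apply: (subset_measure0 mAB mU _ AB0) => x; left.
  by apply: (subset_measure0 mBA mU _ AB0) => x; right.
exact: null_set_setU.
Qed.

Lemma le_null_refl : reflexive le_null.
Proof. by move=> A; apply/asboolP; rewrite setDv measure0. Qed.

Lemma eq_null_refl : reflexive eq_null.
Proof. by move=> A; rewrite eq_nullE le_null_refl. Qed.

Lemma eq_null_sym : symmetric eq_null.
Proof. by move=> A B; rewrite !eq_nullE andbC. Qed.

Lemma eq_null_trans : transitive eq_null.
Proof.
move=> B A C; rewrite !eq_nullE => /andP[AB BA] /andP[BC CB].
by rewrite (le_null_trans AB BC) (le_null_trans CB BA).
Qed.

Canonical eq_null_equiv :=
  EquivRel eq_null eq_null_refl eq_null_sym eq_null_trans.

Local Open Scope quotient_scope.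

Definition malg : Type := {eq_quot eq_null}.
HB.instance Definition _ := Choice.on malg.
HB.instance Definition _ := EqQuotient.on malg.

Definition mclass (A : set T) (mA : measurable A) : malg :=
  \pi_malg (SigSub (mem_set mA) : msets).

Definition mrepr (a : malg) : set T := val (repr a : msets).

Lemma measurable_mrepr (a : malg) : measurable (mrepr a).
Proof. exact: measurable_msets. Qed.

Definition malg_le (a b : malg) : bool := le_null (repr a) (repr b).

Lemma malg_le_refl : reflexive malg_le.
Proof. by move=> a; exact: le_null_refl. Qed.

Lemma malg_le_anti : antisymmetric malg_le.
Proof.
move=> a b; rewrite /malg_le -eq_nullE => ab.
by rewrite -[a]reprK -[b]reprK; apply/eqmodP.
Qed.

Lemma malg_le_trans : transitive malg_le.
Proof. by move=> b a c; exact: le_null_trans. Qed.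

HB.instance Definition _ := Order.Le_isPOrder.Build malg_display malg
  malg_le_refl malg_le_anti malg_le_trans.

Lemma malg_le0 (a : malg) : (mclass measurable0 <= a)%O.
Proof.
rewrite /Order.le/= /malg_le.
apply: (@le_null_trans (SigSub (mem_set measurable0))).
  set z := SigSub _; have : eq_null (repr (\pi_malg z)) z.
    by apply/eqmodP; rewrite reprK.
  by rewrite eq_nullE => /andP[].
by apply/asboolP; rewrite set0D measure0.
Qed.

HB.instance Definition _ := Order.hasBottom.Build malg_display malg malg_le0.

End MeasureAlgebra.

Section LimitMeasure.
Local Open Scope charge_scope.
Context d (T : measurableType d) (R : realType) (P : probability T R).
Variables (U : set_system nat) (UU : UltraFilter U).

(* The (otherwise unused) proof argument lets the measure structure on
   ulim_measure be inferred. *)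
Definition ulim_measure of UltraFilter U := fun (M : nat -> malg P) (B : set T) =>
  lim ((fun k => P (mrepr (M k) `&` B)) @ U).

Variable M : nat -> malg P.
Local Notation mu := (ulim_measure UU M).

Let u (B : set T) (k : nat) : \bar R := P (mrepr (M k) `&` B).

Let mI (B : set T) k : measurable B -> measurable (mrepr (M k) `&` B).
Proof. by move=> mB; apply: measurableI => //; exact: measurable_mrepr. Qed.

Let ultra_cvg (v : nat -> R) : (forall k, 0 <= v k <= 1) ->
  exists l : R, v @ U --> l.
Proof.
move=> v01.
have UvU : UltraFilter (v @ U).
  split=> [|G GF vUG]; first exact: fmap_proper_filter.
  apply/seteqP; split=> // A GA /=.
  have [//|UA] := in_ultra_setVsetC (v @^-1` A) UU.
  have GAC : G (~` A) by exact: vUG.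
  by have [x []] := filter_ex (filterI GA GAC).
have := @segment_compact R 0 1; rewrite compact_ultra => /(_ _ UvU).
case; last by move=> l [_ vl]; exists l.
by apply: (@filterE _ U) => k; rewrite /= in_itv/=; exact: v01.
Qed.

Lemma ulim_measure_cvg (B : set T) : measurable B ->
  exists2 l : R, mu B = l%:E & (fun k => P (mrepr (M k) `&` B)) @ U --> l%:E.
Proof.
move=> mB; have [k|l vl] := @ultra_cvg (fine \o u B).
  have Pfin : u B k \is a fin_num by apply: fin_num_measure; exact: mI.
  rewrite /= -!lee_fin fineK// measure_ge0/=.
  by apply: probability_le1; exact: mI.
have ul : u B @ U --> l%:E.
  apply: cvg_EFin vl; apply: nearW => k.
  by apply: fin_num_measure; exact: mI.
by exists l => //; apply: cvg_lim.
Qed.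

Lemma ulim_measure0 : mu set0 = 0%E.
Proof.
rewrite /ulim_measure (_ : (fun _ => _) = cst 0%E) ?lim_cst//.
by apply/funext => k; rewrite setI0 measure0.
Qed.

Lemma ulim_measure_ge0 (B : set T) : (0 <= mu B)%E.
Proof.
have [ucv|udv] := pselect (cvg (u B @ U)).
  by apply: lime_ge => //; apply: nearW => k; exact: measure_ge0.
by rewrite /ulim_measure dvgP.
Qed.

Lemma ulim_measure_le (B : set T) : measurable B -> (mu B <= P B)%E.
Proof.
move=> mB; have [l muE ul] := ulim_measure_cvg mB.
apply: lime_le; first by apply/cvg_ex; exists l%:E.
by apply: nearW => k; apply: le_measure; rewrite ?inE//; exact: mI.
Qed.

Lemma ulim_measureU (A B : set T) : measurable A -> measurable B ->
  A `&` B = set0 -> mu (A `|` B) = (mu A + mu B)%E.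
Proof.
move=> mA mB AB0; have [a aE ua] := ulim_measure_cvg mA.
have [b bE ub] := ulim_measure_cvg mB; rewrite aE bE.
apply: cvg_lim => //.
rewrite (_ : (fun _ => _) = (fun k => u A k + u B k)%E); last first.
  apply/funext => k; rewrite setIUr measureU//; [exact: mI|exact: mI|].
  by rewrite setIACA AB0 setI0.
exact: cvgeD.
Qed.

Lemma ulim_measure_semi_sigma_additive : semi_sigma_additive mu.
Proof.
move=> F mF tF mUF; set G := \bigcup_n F n.
pose V n := \big[setU/set0]_(i < n) F i.
have mV n : measurable (V n) by apply: bigsetU_measurable => i _.
have mD n : measurable (G `\` V n) by exact: measurableD.
have VG n : V n `<=` G by rewrite /V -bigcup_mkord => x [i _ Fx]; exists i.
have FV n : V n `&` F n = set0.
  rewrite /V -bigcup_mkord setI_bigcupl bigcup0// => i /= ni.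
  by move/trivIsetP : tF; apply => //; rewrite ltn_eqF.
have additive (nu : set T -> \bar R) : nu set0 = 0%E ->
    (forall A B, measurable A -> measurable B -> A `&` B = set0 ->
      nu (A `|` B) = (nu A + nu B)%E) ->
    forall n, (\sum_(0 <= i < n) nu (F i) + nu (G `\` V n) = nu G)%E.
  move=> nu0 nuU n.
  have -> : (\sum_(0 <= i < n) nu (F i) = nu (V n))%E.
    elim: n => [|n IH]; first by rewrite big_nil /V big_ord0.
    by rewrite big_nat_recr//= IH -nuU//; congr nu; rewrite /V big_ord_recr.
  by rewrite -nuU ?setDUK// setDE setICA setICr setI0.
have addmu := additive mu ulim_measure0 ulim_measureU.
have addP := additive P (measure0 P) (fun A B mA mB => measureU P mA mB).
have PD0 : (P (G `\` V n) @[n --> \oo] --> 0)%E.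
  have -> : (fun n => P (G `\` V n)) =
      (fun n => P G - \sum_(0 <= i < n) P (F i))%E.
    apply/funext => n; rewrite -(addP n) [X in (_ = X - _)%E]addeC addeK//.
    by rewrite sum_fin_num; apply/allP => _ /mapP[i _ ->]; exact: fin_num_measure.
  rewrite -[X in _ --> X](subee (fin_num_measure P G mUF)).
  apply: cvgeB; first by rewrite fin_num_adde_defl// fin_numN fin_num_measure.
    exact: cvg_cst.
  exact: measure_semi_sigma_additive.
have muD0 : (mu (G `\` V n) @[n --> \oo] --> 0)%E.
  apply: (squeeze_cvge _ (cvg_cst 0%E) PD0); apply: nearW => n.
  by rewrite ulim_measure_ge0 ulim_measure_le.
have mufin A : measurable A -> mu A \is a fin_num.
  by move=> mA; have [l ->] := ulim_measure_cvg mA.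
have -> : (fun n => \sum_(0 <= i < n) mu (F i))%E =
    (fun n => mu G - mu (G `\` V n))%E.
  by apply/funext => n; rewrite -(addmu n) addeK// mufin.
rewrite -[X in _ --> X]sube0.
by apply: cvgeB => //; [rewrite fin_num_adde_defl|exact: cvg_cst].
Qed.

HB.instance Definition _ := isMeasure.Build d T R mu
  ulim_measure0 ulim_measure_ge0 ulim_measure_semi_sigma_additive.

Lemma ulim_measure_fin : fin_num_fun mu.
Proof. by move=> B mB; have [l ->] := ulim_measure_cvg mB. Qed.

HB.instance Definition _ := Measure_isFinite.Build d T R mu ulim_measure_fin.

Lemma ulim_measure_dominates : charge_of_finite_measure mu `<< P.
Proof.
apply/null_content_dominatesP => B mB PB0; apply/eqP.
by rewrite eq_le ulim_measure_ge0 andbT -PB0 ulim_measure_le.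
Qed.

Definition ulim_density : T -> \bar R :=
  'd (charge_of_finite_measure mu) '/d P.

Lemma measurable_ulim_density : measurable_fun [set: T] ulim_density.
Proof.
exact: measurable_int (Radon_Nikodym_integrable ulim_measure_dominates).
Qed.

End LimitMeasure.

(* The conditions are the nonzero elements of B. A sentence of the forcing
   language is identified with the predicate "is forced by p"; its value at
   \bot is irrelevant. The clauses are the usual ones for conjunction, negation
   and universal quantification, and the other connectives are their classical
   abbreviations. Quantifiers range over elements of ground-model sets such as
   nat or rat (standing for their check names) or over names. *)
Section ForcingLanguage.
Context (disp : Order.disp_t) (B : bPOrderType disp).

Definition sentence := B -> Prop.

Definition extends (q p : B) := q != \bot%O /\ (q <= p)%O.

Definition fconj (phi psi : sentence) : sentence := fun p => phi p /\ psi p.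
Definition fnot (phi : sentence) : sentence :=
  fun p => forall q, extends q p -> ~ phi q.
Definition fall (X : Type) (phi : X -> sentence) : sentence :=
  fun p => forall x, phi x p.

Definition fdisj (phi psi : sentence) := fnot (fconj (fnot phi) (fnot psi)).
Definition fimp (phi psi : sentence) := fnot (fconj phi (fnot psi)).
Definition fiff (phi psi : sentence) := fconj (fimp phi psi) (fimp psi phi).
Definition fex (X : Type) (phi : X -> sentence) :=
  fnot (fall (fun x => fnot (phi x))).

(* absolute statement about ground-model objects *)
Definition fground (Q : Prop) : sentence := fun _ => Q.

Definition forced (phi : sentence) : Prop := forall p, p != \bot%O -> phi p.

(* [A : name X] stands for the name {<x, A x> : x in X} of a subset of the
   ground-model set X, so that [[x \in A]] = A x. Up to forced equality, every
   name for a subset of X has this form. *)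
Definition name (X : Type) := X -> B.

(* subset of X in the extension which is definable from names *)
Definition class (X : Type) := X -> sentence.

Definition cname (X : Type) (A : name X) : class X := fun x p => (p <= A x)%O.
Coercion cname : name >-> class.

Definition cground (X : Type) (A : set X) : class X := fun x => fground (A x).

Section Classes.
Variable X : Type.
Implicit Types C D : class X.

Definition csub C D := fall (fun x => fimp (C x) (D x)).
Definition ceq C D := fall (fun x => fiff (C x) (D x)).
Definition cunion C D : class X := fun x => fdisj (C x) (D x).
Definition cinter C D : class X := fun x => fconj (C x) (D x).
Definition cdiff C D : class X := fun x => fconj (C x) (fnot (D x)).

End Classes.

(* finite sequences of elements of the ground model are in the ground model *)
Definition cfinite (X : eqType) (C : class X) :=
  fex (fun s : seq X => ceq C (cground [set x | x \in s])).
Definition cinfinite (X : eqType) (C : class X) := fnot (cfinite C).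

(* Real numbers of the extension are left Dedekind cuts in the rationals. *)

Definition cut_axioms (x : class rat) : sentence :=
  fconj (fex (fun q => x q))
 (fconj (fex (fun q => fnot (x q)))
       (fall (fun q => fiff (x q) (fex (fun r => fconj (fground (q < r)) (x r)))))).

Definition rat_cut (c : rat) : class rat := cground [set q | q < c].

Definition cut_le (x y : class rat) : sentence := csub x y.

Definition cut_add (x y : class rat) : class rat := fun q =>
  fex (fun r => fex (fun s =>
    fconj (fground (q = r + s)) (fconj (x r) (y s)))).

Definition cut_lim (x : nat -> class rat) (y : class rat) : sentence :=
  fall (fun e : rat => fimp (fground (0 < e))
    (fex (fun N : nat => fall (fun n : nat => fimp (fground (N <= n)%N)
      (fconj (cut_le (x n) (cut_add y (rat_cut e)))
            (cut_le y (cut_add (x n) (rat_cut e)))))))).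

(* A name for a function from P(omega) to the reals is given by its action on
   names; that it respects equality of sets is the sentence setfun_wd. *)

Definition setfun_name := name nat -> name rat.

Definition setfun_wd (mu : setfun_name) : sentence :=
  fall (fun A : name nat => fall (fun A' : name nat =>
    fimp (ceq A A') (ceq (mu A) (mu A')))).

Definition unit_valued (mu : setfun_name) : sentence :=
  fall (fun A : name nat =>
    fconj (cut_axioms (mu A))
   (fconj (cut_le (rat_cut 0) (mu A)) (cut_le (mu A) (rat_cut 1)))).

Definition finitely_additive (mu : setfun_name) : sentence :=
  fall (fun A : name nat => fall (fun A' : name nat => fall (fun C : name nat =>
    fimp (ceq (cinter A A') (cground set0))
   (fimp (ceq C (cunion A A'))
         (ceq (mu C) (cut_add (mu A) (mu A'))))))).

Definition total_mass_one (mu : setfun_name) : sentence :=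
  fall (fun A : name nat =>
    fimp (ceq A (cground [set: nat])) (ceq (mu A) (rat_cut 1))).

Definition fa_probability (mu : setfun_name) : sentence :=
  fconj (setfun_wd mu) (fconj (unit_valued mu)
    (fconj (finitely_additive mu) (total_mass_one mu))).

Definition vanishes_on_singletons (mu : setfun_name) : sentence :=
  fall (fun n : nat => fall (fun A : name nat =>
    fimp (ceq A (cground [set n])) (ceq (mu A) (rat_cut 0)))).

(* [E : nat -> name nat] is a name for a sequence of subsets of omega, as it
   amounts to a name for a subset of omega x omega. *)
Definition P_property (mu : setfun_name) : sentence :=
  fall (fun E : nat -> name nat =>
    fimp (fall (fun n => csub (E n.+1) (E n)))
   (fimp (fall (fun n => cinfinite (E n)))
         (fex (fun A : name nat =>
           fconj (fall (fun n => cfinite (cdiff A (E n))))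
                (cut_lim (fun n => mu (E n)) (mu A)))))).

Definition P_measure (mu : setfun_name) : sentence :=
  fconj (fa_probability mu)
    (fconj (vanishes_on_singletons mu) (P_property mu)).

End ForcingLanguage.

Section Solovay.
Context d (T : measurableType d) (R : realType) (P : probability T R).

Lemma measurable_above (f : T -> \bar R) (q : rat) :
  measurable_fun [set: T] f -> measurable [set x | ((ratr q)%:E < f x)%E].
Proof.
move=> mf; rewrite -[X in measurable X]setTI.
exact: emeasurable_fun_o_infty.
Qed.

(* The name of the real f(r) with r the generic element of T. As [[r \in A]] is
   the class of A for every measurable A of the ground model,
   [[q < f(r)]] is the class of {x | q < f x}. *)
Definition eval_generic (f : T -> \bar R) (mf : measurable_fun [set: T] f) :
    name (malg P) rat :=
  fun q => mclass P (measurable_above q mf).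

Definition solovay_measure (U : set_system nat) (UU : UltraFilter U) :
    setfun_name (malg P) :=
  fun M => eval_generic (measurable_ulim_density UU M).

End Solovay.
Arguments solovay_measure {d T R} P {U} UU.

Definition borel2 (K : Type) := g_sigma_algebraType (@open {ptws K -> bool}).

(* These values on cylinders determine a probability measure on all Borel sets,
   also when K is uncountable: each Borel set lies between two sets of the
   sigma-algebra generated by the cylinders which have the same measure. *)
Definition is_product_measure (R : realType) (K : choiceType)
    (lambda : set (borel2 K) -> \bar R) : Prop :=
  forall (F : {fset K}) (s : K -> bool),
    lambda [set x : borel2 K | {in F, forall i, x i = s i}] =
      (2 ^- #|` F|)%:E.

Definition nonprincipal (U : set_system nat) : Prop := forall n, U <> principal_filter n.

Definition P_point (U : set_system nat) : Prop :=
  [/\ UltraFilter U, nonprincipal U &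
      forall F : set (set nat), F `<=` U -> countable F ->
        exists2 A, U A & forall B, F B -> finite_set (A `\` B)].

(* Main.v *)
(** A sentence of the forcing language built with countable quantifiers has a
Boolean value in the measure algebra, represented by the measurable set of all
[x] at which the sentence holds when names are evaluated at [x]. Forcing by [p]
thus means holding almost everywhere on [p], and the Solovay measure of [M]
becomes the density of [lim_U P (M k & B)] at [x].

For the P-property, let [E n] be decreasing on a condition [D] and let [c] be
the infimum of the masses [mu_(E n) D]. The sets of [k] with
[P (E n k & D) > c - 1/(n+1)] belong to [U]; a pseudointersection [X] of them
gives [g] with [g k -> oo] along [X] such that [A k := E (g k) k] on [X]
(and [0] elsewhere) satisfies [mu_A D >= c]. At almost every [x] in [D] the set
[A] is almost included in each [E n], hence [density A <= density (E n)], and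
as no mass is lost the decreasing densities of the [E n] converge to that of
[A]. *)

Require Import Defs.
From mathcomp Require Import all_boot all_order all_algebra.
From mathcomp Require Import finmap.
From mathcomp Require Import all_classical all_reals all_analysis.
From mathcomp Require Import measurable_realfun.

Set Implicit Arguments.
Unset Strict Implicit.
Unset Printing Implicit Defensive.

Import Order.TTheory GRing.Theory Num.Theory.
Import numFieldNormedType.Exports.

Local Open Scope classical_set_scope.
Local Open Scope ring_scope.

(** * Countable families of null sets and measurable sets *)

Section CountableFamilies.
Context d (T : measurableType d) (R : realType).
Variable mu : {measure set T -> \bar R}.

(** Countable quantifiers range over types such as [nat], [rat] or [seq nat]; an enumeration of the
    type merges the exceptional null sets of the instances. *)
Lemma negligible_countable_bigcup (X : countType) (F : X -> set T) :
  (forall i, mu.-negligible (F i)) -> mu.-negligible (\bigcup_i F i).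
Proof.
move=> NF; pose G n := oapp F set0 (choice.unpickle n).
apply: (@negligibleS _ _ _ _ (\bigcup_n G n)).
  move=> x [i _ Fix]; exists (choice.pickle i) => //.
  by rewrite /G choice.pickleK.
apply: negligible_bigcup => n; rewrite /G; case: (choice.unpickle n) => [i|].
  exact: NF.
exact: negligible_set0.
Qed.

Lemma measurable_forall (X : countType) (F : X -> set T) :
  (forall i, measurable (F i)) -> measurable [set x | forall i, F i x].
Proof.
move=> mF.
rewrite (_ : [set x | _] = ~` \bigcup_i ~` F i).
  apply: measurableC; apply: countable_bigcupT_measurable => [|i].
    exact: countableP.
  exact: measurableC.
by rewrite setC_bigcup; apply/seteqP; split=> x /= Fx i; [|move: (Fx i)];
  rewrite setCK// => /(_ I).
Qed.

End CountableFamilies.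

(** * The order of the measure algebra in terms of null sets *)

Section MeasureAlgebraTheory.
Context d (T : measurableType d) (R : realType) (P : probability T R).
Implicit Types (p q : malg P) (S : set T).

Lemma measurable_mreprI p S : measurable S -> measurable (mrepr p `&` S).
Proof. by move=> mS; apply: measurableI => //; exact: measurable_mrepr. Qed.

Lemma negligible_mrepr_mclassD S (mS : measurable S) :
  P.-negligible (mrepr (mclass P mS) `\` S).
Proof.
have : eq_null P (repr (mclass P mS)) (SigSub (mem_set mS)).
  by apply/eqmodP; rewrite reprK.
rewrite eq_nullE => /andP[/asboolP + _]; rewrite /= => P0.
by apply/negligibleP => //; apply: measurableD => //; exact: measurable_mrepr.
Qed.

Lemma negligible_mreprD_mclass S (mS : measurable S) :
  P.-negligible (S `\` mrepr (mclass P mS)).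
Proof.
have : eq_null P (repr (mclass P mS)) (SigSub (mem_set mS)).
  by apply/eqmodP; rewrite reprK.
rewrite eq_nullE => /andP[_ /asboolP]; rewrite /= => P0.
by apply/negligibleP => //; apply: measurableD => //; exact: measurable_mrepr.
Qed.

(** Negligibility is inherited by arbitrary subsets, so the order can be handled through pointwise
    inclusions. *)
Lemma malg_leP p q : (p <= q)%O <-> P.-negligible (mrepr p `\` mrepr q).
Proof.
rewrite negligibleP; last by apply: measurableD; exact: measurable_mrepr.
by split=> [/asboolP|/asboolP].
Qed.

Lemma malg_botP p : p = \bot%O <-> P.-negligible (mrepr p).
Proof.
split=> [->|p0].
  have := @negligible_mrepr_mclassD _ (@measurable0 _ T).
  by rewrite setD0.
apply/le_anti; rewrite le0x andbT; apply/malg_leP.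
by apply: negligibleS p0 => x [].
Qed.

Lemma negligible_extends p q S : extends q p ->
  P.-negligible (mrepr p `\` S) -> P.-negligible (mrepr q `\` S).
Proof.
move=> [_ /malg_leP qp] pS; apply: negligibleS (negligibleU qp pS) => x [qx Sx].
by have [px|px] := pselect (mrepr p x); [right|left].
Qed.

End MeasureAlgebraTheory.
Arguments negligible_mrepr_mclassD {d T R} P {S} mS.
Arguments negligible_mreprD_mclass {d T R} P {S} mS.

(** * Boolean values of sentences *)

Section TruthValues.
Context d (T : measurableType d) (R : realType) (P : probability T R).
Implicit Types (p q : malg P) (phi psi : sentence (malg P)) (S : set T).

(* [S] is a representative of the Boolean value of [phi]. *)
Definition truth_value phi S := measurable S /\
  forall p, p != \bot%O -> phi p <-> P.-negligible (mrepr p `\` S).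

Lemma truth_value_ae phi S S' : truth_value phi S -> measurable S' ->
  (\forall x \ae P, S x <-> S' x) -> truth_value phi S'.
Proof.
move=> [mS phiS] mS' SS'; split=> // p /phiS ->.
have N : P.-negligible (~` [set x | S x <-> S' x]) by exact: SS'.
by split=> pS; apply: negligibleS (negligibleU N pS) => x [px Sx];
  have [e|] := pselect (S x <-> S' x); do ?[by left]; right; split => // /e.
Qed.

Lemma truth_value_ground (Q : Prop) :
  truth_value (fground Q) [set _ | Q].
Proof.
have [q|q] := pselect Q.
  rewrite (_ : [set _ | Q] = setT); last by apply/seteqP; split.
  split=> // p _; rewrite setDT; split=> // _; exact: negligible_set0.
(* For false [Q] the value is empty, and only the zero condition is almost contained in it. *)
rewrite (_ : [set _ | Q] = set0); last by apply/seteqP; split.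
split=> // p p0; rewrite setD0; split=> // /malg_botP pE.
by rewrite pE eqxx in p0.
Qed.

Lemma truth_value_and phi psi S S' : truth_value phi S -> truth_value psi S' ->
  truth_value (fconj phi psi) [set x | S x /\ S' x].
Proof.
move=> [mS phiS] [mS' psiS']; split; first exact: (measurableI S S').
move=> p p0; rewrite /fconj phiS// psiS'//; split=> [[a b]|N].
  apply: negligibleS (negligibleU a b) => x [px /not_andP[Sx|Sx]].
    by left.
  by right.
by split; apply: negligibleS N => x [px Sx]; split=> // -[].
Qed.

(** If [p] met [S] in a non-null set, the class of the intersection would be an extension of [p]
    forcing [phi]. Conversely, an extension of [p] forcing [phi] is almost inside [S]; when [p] is
    almost disjoint from [S], it is zero. *)
Lemma truth_value_not phi S : truth_value phi S ->
  truth_value (fnot phi) [set x | ~ S x].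
Proof.
move=> [mS phiS]; split; first exact: measurableC.
move=> p p0; split=> [Nphi|NS q pq].
  have mpS := measurable_mreprI p mS.
  pose q := mclass P mpS.
  have [/malg_botP q0|q0] := eqVneq q \bot%O.
    apply: negligibleS (negligibleU q0 (negligible_mreprD_mclass P mpS)).
    move=> x [px /contrapT Sx].
    by have [qx|qx] := pselect (mrepr q x); [left|right].
  exfalso; apply: (Nphi q); last apply/phiS => //.
    split=> //; apply/malg_leP.
    apply: negligibleS (negligible_mrepr_mclassD P mpS) => x [qx px].
    by split=> // -[].
  apply: negligibleS (negligible_mrepr_mclassD P mpS) => x [qx px].
  by split=> // -[].
have [q0 _] := pq; rewrite phiS// => qS; case/negP: q0; apply/eqP/malg_botP.
apply: negligibleS (negligibleU qS (negligible_extends pq NS)) => x qx.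
by have [Sx|Sx] := pselect (S x); [right|left]; split=> //; apply.
Qed.

(** Countability enters here: the exceptional null sets of the single instances have a null
    union. *)
Lemma truth_value_forall (X : countType) (phi : X -> sentence (malg P))
    (S : X -> set T) : (forall i, truth_value (phi i) (S i)) ->
  truth_value (fall phi) [set x | forall i, S i x].
Proof.
move=> phiS; split.
  by apply: measurable_forall => i; case: (phiS i).
move=> p p0; split=> [phip|NS i].
  apply: (@negligibleS _ _ _ _ (\bigcup_i (mrepr p `\` S i))).
    by move=> x [px /existsNP[i Si]]; exists i.
  by apply: negligible_countable_bigcup => i; apply/(phiS i).2.
by apply/(phiS i).2 => //; apply: negligibleS NS => x [px Sx]; split.
Qed.

Lemma truth_value_ext phi S S' : truth_value phi S ->
  (forall x, S x <-> S' x) -> truth_value phi S'.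
Proof.
move=> phiS SS'; rewrite (_ : S' = S)//.
by apply/seteqP; split=> x /SS'.
Qed.

Lemma truth_value_or phi psi S S' : truth_value phi S -> truth_value psi S' ->
  truth_value (fdisj phi psi) [set x | S x \/ S' x].
Proof.
move=> phiS psiS'; apply: truth_value_ext.
  exact: truth_value_not (truth_value_and (truth_value_not phiS)
    (truth_value_not psiS')).
by move=> x /=; split=> [/not_andP[/contrapT|/contrapT]|]; tauto.
Qed.

Lemma truth_value_imp phi psi S S' : truth_value phi S -> truth_value psi S' ->
  truth_value (fimp phi psi) [set x | S x -> S' x].
Proof.
move=> phiS psiS'; apply: truth_value_ext.
  exact: truth_value_not (truth_value_and phiS (truth_value_not psiS')).
by move=> x /=; split=> [/not_andP[|/contrapT]|]; tauto.
Qed.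

Lemma truth_value_iff phi psi S S' : truth_value phi S -> truth_value psi S' ->
  truth_value (fiff phi psi) [set x | S x <-> S' x].
Proof.
move=> phiS psiS'; exact: truth_value_and (truth_value_imp phiS psiS')
  (truth_value_imp psiS' phiS).
Qed.

Lemma truth_value_exists (X : countType) (phi : X -> sentence (malg P))
    (S : X -> set T) : (forall i, truth_value (phi i) (S i)) ->
  truth_value (fex phi) [set x | exists i, S i x].
Proof.
move=> phiS; apply: truth_value_ext.
  exact: truth_value_not
    (truth_value_forall (fun i => truth_value_not (phiS i))).
by move=> x /=; split=> [/existsNP[i /contrapT Si]|[i Si] /(_ i)//]; exists i.
Qed.

Lemma truth_value_name (X : Type) (A : name (malg P) X) i :
  truth_value (cname A i) (mrepr (A i)).
Proof. by split=> [|p _]; [exact: measurable_mrepr|exact: malg_leP]. Qed.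

Lemma truth_value_mclass S (mS : measurable S) :
  truth_value (fun p => p <= mclass P mS)%O S.
Proof.
apply: (@truth_value_ae _ (mrepr (mclass P mS))) => //.
  by split=> [|p _]; [exact: measurable_mrepr|exact: malg_leP].
apply: negligibleS (negligibleU (negligible_mreprD_mclass P mS)
  (negligible_mrepr_mclassD P mS)).
move=> x /=; rewrite /setD/=.
by have := pselect (mrepr (mclass P mS) x); have := pselect (S x); tauto.
Qed.

(** Quantifiers over names are not countable, so sentences containing them are treated directly on
    conditions, by this rule and the next. *)
Lemma fimp_intro phi psi p :
  (forall q, extends q p -> phi q -> psi q) -> fimp phi psi p.
Proof.
move=> H q pq [phiq Npsi]; apply: (Npsi q) (H _ pq phiq).
by split=> //; case: pq.
Qed.

Lemma fex_intro (X : Type) (phi : X -> sentence (malg P)) i p :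
  (forall q, extends q p -> phi i q) -> fex phi p.
Proof.
move=> H q pq Nphi; apply: (Nphi i q) (H _ pq).
by split=> //; case: pq.
Qed.

End TruthValues.
Arguments truth_value_ground {d T R} P Q.
Arguments truth_value_mclass {d T R} P {S} mS.

(** * Densities of ultrafilter limits *)

Section Densities.
Context d (T : measurableType d) (R : realType).

(** On the part [B] of [D] where [g < f] the difference is positive, yet its integral is at most 0;
    hence [B] is null. This turns comparisons of masses into almost everywhere comparisons of
    densities. *)
Lemma negligible_lt_integral (mu : {measure set T -> \bar R})
    (f g : T -> \bar R) (D : set T) : measurable D ->
  mu.-integrable [set: T] f -> mu.-integrable [set: T] g ->
  (forall B, measurable B -> B `<=` D ->
    (\int[mu]_(x in B) f x <= \int[mu]_(x in B) g x)%E) ->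
  mu.-negligible (D `&` [set x | (g x < f x)%E]).
Proof.
move=> mD intf intg fg; set B := D `&` _.
have mB : measurable B.
  apply: measurable_lte => //.
    by apply: measurable_funS (measurable_int mu intg).
  by apply: measurable_funS (measurable_int mu intf).
have intfB : mu.-integrable B f by apply: integrableS intf.
have intgB : mu.-integrable B g by apply: integrableS intg.
(* A strict inequality excludes equal infinities, so the difference is meaningful and positive at
   infinite values too. *)
have fgB : forall x, B x -> (0 < f x - g x)%E.
  move=> x [_ /=]; case: (f x) (g x) => [r| |] [s| |]//=;
    by rewrite -?EFinB ?lte_fin ?subr_gt0// ?addey// ?addye.
have ifg0 : (\int[mu]_(x in B) `|f x - g x| = 0)%E.
  apply/eqP; rewrite eq_le integral_ge0 ?andbT//.
  rewrite (eq_integral (fun x => f x - g x)%E); last first.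
    by move=> x /set_mem Bx; rewrite gee0_abs// ltW// fgB.
  rewrite integralB// sube_le0; exact: (fg _ mB (@subIsetl _ _ _)).
have fg0 : ae_eq mu B (fun x => f x - g x)%E (cst 0%E).
  by apply/ae_eq_integral_abs => //; apply: emeasurable_funB;
    [exact: measurable_int intfB|exact: measurable_int intgB].
apply: negligibleS fg0 => x Bx /= /(_ Bx) fg0.
by have := fgB x Bx; rewrite fg0 ltxx.
Qed.

Context (P : probability T R) (U : set_system nat) (UU : UltraFilter U).
Implicit Type M : nat -> malg P.

(* A version of the Radon-Nikodym derivative, which is only almost everywhere
   in [[0, 1]]. *)
Definition density M (x : T) : R :=
  Num.max 0 (Num.min 1 (fine (ulim_density UU M x))).

Lemma density_ge0 M x : 0 <= density M x.
Proof. by rewrite /density le_max lexx. Qed.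

Lemma density_le1 M x : density M x <= 1.
Proof. by rewrite /density ge_max ler01 ge_min lexx. Qed.

Lemma measurable_density M : measurable_fun [set: T] (density M).
Proof.
apply: measurable_maxr => //; apply: measurable_minr => //.
apply: measurableT_comp; first exact: fine_measurable.
exact: measurable_ulim_density.
Qed.

Lemma integrable_density M : P.-integrable [set: T] (EFin \o density M).
Proof.
apply: measurable_bounded_integrable => //.
- by rewrite (le_lt_trans (probability_le1 P measurableT))// ltry.
- exact: measurable_density.
exists 1; split=> // r r1 x _ /=.
by rewrite ger0_norm ?density_ge0// (le_trans (density_le1 M x))// ltW.
Qed.

Lemma integral_ulim_density M B : measurable B ->
  (\int[P]_(x in B) ulim_density UU M x = ulim_measure UU M B)%E.
Proof.
by move=> mB; rewrite -Radon_Nikodym_integral//; exact: ulim_measure_dominates.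
Qed.

(** Every measurable [B] has mass between 0 and [P B]; comparing with the constants 0 and 1 puts the
    derivative almost everywhere in the unit interval, where truncation changes nothing. *)
Lemma ae_ulim_density M :
  \forall x \ae P, ulim_density UU M x = (density M x)%:E.
Proof.
have intf : P.-integrable [set: T] (ulim_density UU M).
  exact: Radon_Nikodym_integrable (ulim_measure_dominates UU M).
have N0 : P.-negligible (setT `&` [set x | ulim_density UU M x < cst 0 x]%E).
  apply: negligible_lt_integral => //; first exact: integrable0.
  by move=> B mB _; rewrite integral_cst// mul0e integral_ulim_density.
have N1 : P.-negligible
    (setT `&` [set x | (EFin \o cst (1%R : R)) x < ulim_density UU M x]%E).
  apply: negligible_lt_integral => //.
    exact: finite_measure_integrable_cst.
  move=> B mB _; rewrite [leRHS](integral_cst P mB 1%:E) mul1e.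
  rewrite integral_ulim_density//.
  exact: ulim_measure_le.
apply: negligibleS (negligibleU N0 N1) => x /=.
rewrite /density; case: (ulim_density UU M x) => [r| |] /= H.
- rewrite !lte_fin.
  have [r0|r0] := ltP r 0; first by left.
  have [r1|r1] := ltP 1 r; first by right.
  by exfalso; apply: H; rewrite min_r// max_r.
- by right; rewrite ltry.
- by left; rewrite ltNyr.
Qed.

Lemma integral_density M B : measurable B ->
  (\int[P]_(x in B) (density M x)%:E = ulim_measure UU M B)%E.
Proof.
move=> mB; rewrite -integral_ulim_density//; apply: ae_eq_integral => //.
- by apply/measurable_EFinP; apply: measurable_funS (measurable_density M).
- by apply: measurable_funS (measurable_ulim_density UU M).
- by apply: filterS (ae_ulim_density M) => x /= -> _.
Qed.

End Densities.

(** * Comparing limit measures and their densities *)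

Section UltrafilterLimits.
Context d (T : measurableType d) (R : realType) (P : probability T R).
Context (U : set_system nat) (UU : UltraFilter U).
Implicit Types (M A C : nat -> malg P) (B D : set T).

Lemma le_measure_negligibleD B D : measurable B -> measurable D ->
  P.-negligible (B `\` D) -> (P B <= P D)%E.
Proof.
move=> mB mD N; have mBD := measurableD mB mD.
have -> : P B = (P (B `&` D) + P (B `\` D))%E.
  by rewrite addeC -measureDI.
rewrite (measure_negligible mBD N) adde0.
by apply: le_measure; rewrite ?inE//; exact: measurableI.
Qed.

Lemma le_ulim_measure M M' B : measurable B ->
  (\forall k \near U, P (mrepr (M k) `&` B) <= P (mrepr (M' k) `&` B))%E ->
  (ulim_measure UU M B <= ulim_measure UU M' B)%E.
Proof.
move=> mB MM'; have [l _ Ml] := ulim_measure_cvg UU M mB.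
have [l' _ Ml'] := ulim_measure_cvg UU M' mB.
by apply: lee_lim => //; [apply/cvg_ex; exists l%:E|apply/cvg_ex; exists l'%:E].
Qed.

(** Almost inclusion for [U]-many [k] orders the masses of every measurable part of [D], and these
    masses are the integrals of the densities. *)
Lemma negligible_density_le M M' D : measurable D ->
  (\forall k \near U, P.-negligible (D `&` mrepr (M k) `\` mrepr (M' k))) ->
  P.-negligible (D `\` [set x | density UU M x <= density UU M' x]).
Proof.
move=> mD MM'.
have := @negligible_lt_integral _ _ _ P _ _ D mD (integrable_density UU M)
  (integrable_density UU M').
move=> H; apply: negligibleS (H _).
  by move=> x [Dx /= /negP]; rewrite -ltNge; split=> //; rewrite lte_fin.
move=> B mB BD; rewrite !integral_density//; apply: le_ulim_measure => //.
apply: filterS MM' => k N.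
apply: le_measure_negligibleD; do 2?[exact: measurable_mreprI].
apply: negligibleS N => x [[Mx Bx] NM'x]; split; first by split=> //; exact: BD.
by move=> M'x; apply: NM'x.
Qed.

(** The density never exceeds 1; for the lower bound, each [M k] contains almost all of any
    measurable part [B] of [D], whose mass is therefore at least [P B]. *)
Lemma negligible_density_eq1 M D : measurable D ->
  (forall k, P.-negligible (D `\` mrepr (M k))) ->
  P.-negligible (D `\` [set x | density UU M x = 1]).
Proof.
move=> mD DM.
have := @negligible_lt_integral _ _ _ P (EFin \o cst 1) _ D mD
  (finite_measure_integrable_cst P 1 measurableT) (integrable_density UU M).
move=> H; apply: negligibleS (H _).
  move=> x [Dx /= /eqP]; rewrite eq_le density_le1/= -ltNge.
  by split=> //; rewrite lte_fin.
move=> B mB BD; rewrite [leLHS](integral_cst P mB 1%:E) mul1e.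
rewrite integral_density//.
have [l -> Ml] := ulim_measure_cvg UU M mB.
rewrite -(cvg_lim _ Ml)//; apply: lime_ge; first by apply/cvg_ex; exists l%:E.
apply: nearW => k; apply: le_measure_negligibleD => //.
  exact: measurable_mreprI.
apply: negligibleS (DM k) => x [Bx Nx]; split; first exact: BD.
by move=> Mx; apply: Nx.
Qed.

Lemma negligible_density_eq0 M D : measurable D ->
  (\forall k \near U, P.-negligible (D `&` mrepr (M k))) ->
  P.-negligible (D `\` [set x | density UU M x = 0]).
Proof.
move=> mD DM.
have := @negligible_lt_integral _ _ _ P _ (cst 0%E) D mD
  (integrable_density UU M) (integrable0 _ _).
move=> H; apply: negligibleS (H _).
  move=> x [Dx /= /eqP]; rewrite eq_le density_ge0/= andbT -ltNge.
  by split=> //; rewrite lte_fin.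
move=> B mB BD; rewrite integral_cst// mul0e integral_density//.
have [l -> Ml] := ulim_measure_cvg UU M mB.
rewrite -(cvg_lim _ Ml)//; apply: lime_le; first by apply/cvg_ex; exists l%:E.
apply: filterS DM => k N.
rewrite (measure_negligible (measurable_mreprI _ mB))//.
by apply: negligibleS N => x [Mx Bx]; split=> //; exact: BD.
Qed.

Lemma ulim_measureD A A' C B : measurable B ->
  (forall k, P.-negligible (B `&` (mrepr (A k) `&` mrepr (A' k)))) ->
  (forall k, P.-negligible
    (B `\` [set x | mrepr (C k) x <-> mrepr (A k) x \/ mrepr (A' k) x])) ->
  (ulim_measure UU C B = ulim_measure UU A B + ulim_measure UU A' B)%E.
Proof.
move=> mB AA' CAA'; have [a -> Aa] := ulim_measure_cvg UU A mB.
have [a' -> Aa'] := ulim_measure_cvg UU A' mB.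
apply: cvg_lim => //.
rewrite (_ : (fun _ => _) =
    (fun k => P (mrepr (A k) `&` B) + P (mrepr (A' k) `&` B))%E).
  exact: cvgeD.
apply/funext => k.
have mI (M : nat -> malg P) := measurable_mreprI (M k) mB.
have mA := mI A; have mA' := mI A'; have mC := mI C.
transitivity (P ((mrepr (A k) `&` B) `|` (mrepr (A' k) `&` B))).
  have mU := measurableU _ _ mA mA'.
  apply/eqP; rewrite eq_le; apply/andP.
  split; apply: le_measure_negligibleD => //.
    apply: negligibleS (CAA' k) => x [[Cx Bx] Nx]; split=> // -[/(_ Cx) + _].
    by case=> ?; apply: Nx; [left|right].
  apply: negligibleS (CAA' k) => x [+ Nx]; case=> -[Ax Bx]; split=> // -[_ H];
    by apply: Nx; split=> //; apply: H; tauto.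
(* Disjointness holds only up to a null set: removing [A k] from [A' k] makes the union disjoint and
   changes no measure. *)
have mAA' := measurableD mA' mA.
have -> : (mrepr (A k) `&` B) `|` (mrepr (A' k) `&` B) =
    (mrepr (A k) `&` B) `|` ((mrepr (A' k) `&` B) `\` (mrepr (A k) `&` B)).
  apply/seteqP; split=> x; rewrite /setU /setD /setI/=;
    by have := pselect (mrepr (A k) x); tauto.
rewrite measureU//; last exact: setDIK.
congr (_ + _)%E; apply/eqP; rewrite eq_le; apply/andP.
split; apply: le_measure_negligibleD => //.
  by apply: negligibleS (negligible_set0 P) => x [[A'x _] /(_ A'x)].
by apply: negligibleS (AA' k) => x [[A'x Bx] /= Nx]; split=> //; split=> //;
  apply: contrapT => NAx; apply: Nx; split=> // -[].
Qed.

Lemma negligible_density_add A A' C D : measurable D ->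
  (forall k, P.-negligible (D `&` (mrepr (A k) `&` mrepr (A' k)))) ->
  (forall k, P.-negligible
    (D `\` [set x | mrepr (C k) x <-> mrepr (A k) x \/ mrepr (A' k) x])) ->
  P.-negligible
    (D `\` [set x | density UU C x = density UU A x + density UU A' x]).
Proof.
move=> mD AA' CAA'.
have intA := integrable_density UU A; have intA' := integrable_density UU A'.
have intC := integrable_density UU C.
have intD := integrableD measurableT intA intA'.
have eqint B : measurable B -> B `<=` D ->
    (\int[P]_(x in B) (density UU C x)%:E =
     \int[P]_(x in B) ((density UU A x)%:E + (density UU A' x)%:E))%E.
  move=> mB BD; rewrite integralD//; last first.
    - by apply: integrableS intA'.
    - by apply: integrableS intA.
  rewrite !integral_density//; apply: ulim_measureD => // k.
    by apply: negligibleS (AA' k) => x [/BD].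
  by apply: negligibleS (CAA' k) => x [/BD].
have N1 := @negligible_lt_integral _ _ _ P _ _ D mD intC intD.
have N2 := @negligible_lt_integral _ _ _ P _ _ D mD intD intC.
apply: negligibleS (negligibleU (N1 _) (N2 _)).
- move=> x [Dx /= /eqP]; rewrite neq_lt => /orP[?|?]; [right|left];
    by split=> //; rewrite /= -EFinD lte_fin.
- by move=> B mB BD; rewrite eqint.
- by move=> B mB BD; rewrite eqint.
Qed.

End UltrafilterLimits.

(** * Diagonalization along a P-point *)

(** An ultrafilter containing a singleton is principal, so the points below [m] can be removed one
    at a time. *)
Lemma ultrafilter_tail (U : set_system nat) (UU : UltraFilter U) m :
  nonprincipal U -> U [set k | (m <= k)%N].
Proof.
move=> nU; elim: m => [|m IH]; first by apply: filterS filterT => k.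
have Um : U (~` [set m]).
  have [Um|//] := in_ultra_setVsetC [set m] UU.
  exfalso; apply: (nU m); apply/seteqP; split=> A.
    move=> UA; have [x [/= -> Am]] := filter_ex (filterI Um UA).
    by move=> _ ->.
  by move=> Am; apply: filterS Um.
apply: filterS (filterI IH Um) => k /= [mk km]; rewrite ltn_neqAle mk andbT.
by apply/eqP => mE; apply: km.
Qed.

(** [g k] is the largest [n <= k] with [k] in [Y n], or 0 if there is none; [X] is a
    pseudointersection of the [Y n] cut down to [Y 0]. If [k] is in [X] and [g k < n], then [k < n]
    or [k] is outside [Y n], which leaves finitely many [k]. *)
Lemma P_point_diagonal (U : set_system nat) (Y : nat -> set nat) :
  P_point U -> (forall n, U (Y n)) ->
  exists X (g : nat -> nat), [/\ U X, forall k, X k -> Y (g k) k,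
    forall n, finite_set [set k | X k /\ (g k < n)%N] &
    forall n, U [set k | (n <= g k)%N]].
Proof.
move=> [UU nU pU] UY.
have [||A0 UA0 YA0] := pU (range Y).
- by move=> _ [n _ <-]; exact: UY.
- exact: sub_countable (card_image_le _ _) (countableP _).
(* The bound [m <= k] makes the maximum exist even when [k] lies in every [Y m]. *)
have /choice[g gP] (k : nat) : exists n,
    (Y 0%N k -> Y n k) /\ forall m, (m <= k)%N -> Y m k -> (m <= n)%N.
  have [Y0k|Y0k] := pselect (exists2 m, (m <= k)%N & Y m k); last first.
    exists 0%N; split=> // m mk Ymk; exfalso; apply: Y0k; by exists m.
  pose Q m := (m <= k)%N && `[< Y m k >].
  have exQ : exists m, Q m.
    by case: Y0k => m mk ?; exists m; rewrite /Q mk; apply/asboolP.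
  have ubQ m : Q m -> (m <= k)%N by case/andP.
  case: (ex_maxnP exQ ubQ) => n /andP[_ /asboolP Ynk] nmax.
  exists n; split=> // m mk Ymk.
  by apply: nmax; rewrite /Q mk; apply/asboolP.
have gY n k : (n <= k)%N -> Y n k -> (n <= g k)%N by have [_] := gP k; apply.
exists (A0 `&` Y 0%N), g; split.
- exact: filterI.
- by move=> k [_]; have [] := gP k.
- move=> n; apply: (@sub_finite_set _ _ (`I_n `|` (A0 `\` Y n))).
    move=> k /= [[A0k _] gkn]; have [kn|nk] := ltnP k n; [by left|right].
    by split=> // Ynk; have := gY _ _ nk Ynk; rewrite leqNgt gkn.
  by rewrite finite_setU; split; [exact: finite_II|apply: YA0; exists n].
- move=> n; apply: filterS (filterI (ultrafilter_tail UU n nU) (UY n)).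
  by move=> k [/= nk Ynk]; exact: gY.
Qed.

(** * The diagonal pseudointersection and its density *)

Section PProperty.
Context d (T : measurableType d) (R : realType) (P : probability T R).
Context (U : set_system nat) (UU : UltraFilter U).
Implicit Types (M : nat -> malg P) (B D : set T).

Lemma negligible_decreasing (E : nat -> nat -> malg P) D :
  (forall n k, P.-negligible (D `&` mrepr (E n.+1 k) `\` mrepr (E n k))) ->
  forall n m k, (n <= m)%N ->
    P.-negligible (D `&` mrepr (E m k) `\` mrepr (E n k)).
Proof.
move=> decE n m k /subnK <-; elim: (m - n)%N => [|j IH].
  by apply: negligibleS (negligible_set0 P) => x [[_ Ex]].
apply: negligibleS (negligibleU IH (decE (j + n)%N k)) => x [[Dx Ex] NEx].
by have [Ejx|Ejx] := pselect (mrepr (E (j + n)%N k) x); [left|right].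
Qed.

(* The diagonal name [k |-> E (g k) k] keeps all the mass of the [E n] on [D]
   as soon as [g] tends to infinity slowly enough along [U]. *)
Lemma P_point_pseudointersection (E : nat -> nat -> malg P) D :
  P_point U -> measurable D ->
  (forall n k, P.-negligible (D `&` mrepr (E n.+1 k) `\` mrepr (E n k))) ->
  exists A : nat -> malg P,
  [/\ P.-negligible (D `\` [set x | forall n,
        finite_set [set k | mrepr (A k) x /\ ~ mrepr (E n k) x]]),
      forall n, \forall k \near U,
        P.-negligible (D `&` mrepr (A k) `\` mrepr (E n k)) &
      forall a, (forall n, a%:E <= ulim_measure UU (E n) D)%E ->
        (a%:E <= ulim_measure UU A D)%E].
Proof.
move=> pU mD decE; have {}decE := negligible_decreasing decE.
pose m n := fine (ulim_measure UU (E n) D).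
have mE n : ulim_measure UU (E n) D = (m n)%:E.
  by rewrite /m; have [l -> _] := ulim_measure_cvg UU (E n) mD.
pose c := inf (range m).
have cm n : c <= m n.
  apply: ge_inf; last by exists n.
  by exists 0 => _ [i _ <-]; rewrite -lee_fin -mE measure_ge0.
pose Y n := [set k | (c - n.+1%:R^-1)%:E < P (mrepr (E n k) `&` D)]%E.
(* Otherwise the [U]-limit of the masses of [E n k] on [D] would be at most [c - 1/(n+1)], although
   it is at least [c]. *)
have UY n : U (Y n).
  have [//|UNY] := in_ultra_setVsetC (Y n) UU.
  have [l lE El] := ulim_measure_cvg UU (E n) mD.
  suff : (ulim_measure UU (E n) D <= (c - n.+1%:R^-1)%:E)%E.
    rewrite mE lee_fin => /(le_trans (cm n)).
    by rewrite lerDl oppr_ge0 leNgt invr_gt0 ltr0n.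
  apply: lime_le; first by apply/cvg_ex; exists l%:E.
  by apply: filterS UNY => k /negP; rewrite -leNgt.
have [X [g [UX Yg fg Ug]]] := P_point_diagonal pU UY.
pose A k : malg P := if `[< X k >] then E (g k) k else \bot%O.
have AX k : X k -> A k = E (g k) k by rewrite /A; case: asboolP.
have AE n : \forall k \near U,
    P.-negligible (D `&` mrepr (A k) `\` mrepr (E n k)).
  apply: filterS (filterI UX (Ug n)) => k /= [Xk ngk].
  by rewrite AX//; exact: decE.
exists A; split => //.
  (* [N k] collects the bad points at [k]: off [X] the null representative of [\bot], on [X] the
     points of [D] in [E (g k) k] missing some [E n k] with [n <= g k]. Elsewhere on [D], [A k]
     leaves [E n k] only if [k] is in [X] and [g k < n], hence finitely often. *)
  pose N k := if `[< X k >] then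
    \bigcup_(n in `I_(g k).+1) (D `&` mrepr (E (g k) k) `\` mrepr (E n k))
    else mrepr (A k).
  have NN k : P.-negligible (N k).
    rewrite /N /A; case: asboolP => _; last exact/malg_botP.
    rewrite bigcup_mkcond; apply: negligible_bigcup => n.
    case: ifPn => [/set_mem|_]; last exact: negligible_set0.
    by rewrite /= ltnS; exact: decE.
  apply: negligibleS (negligible_bigcup NN) => x [Dx /existsNP[n]].
  move=> NF; apply: contrapT => NNx; apply: NF.
  apply: sub_finite_set (fg n) => k /= [Ax NEx].
  have Xk : X k.
    apply: contrapT => NXk; apply: NNx; exists k => //.
    by rewrite /N; case: asboolP.
  split=> //; rewrite ltnNge; apply/negP => ngk; apply: NNx; exists k => //.
  rewrite /N; case: asboolP => // _; exists n; first by rewrite /= ltnS.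
  by rewrite AX in Ax.
move=> a am.
have ac : a <= c.
  apply: lb_le_inf; first by exists (m 0%N); exists 0%N.
  by move=> _ [n _ <-]; rewrite -lee_fin -mE.
have [l lE Al] := ulim_measure_cvg UU A mD.
(* If [l < c], some [n] has [l + 1/(n+1) < c]. But for [U]-many [k] one has [n <= g k], so [A k] has
   mass above [c - 1/(g k + 1)], hence above [c - 1/(n+1)], on [D]. *)
rewrite lE lee_fin (le_trans ac)// leNgt; apply/negP => /ltr_add_invr[n].
apply/negP; rewrite -leNgt -lerBlDr -lee_fin -lE.
apply: lime_ge; first by apply/cvg_ex; exists l%:E.
apply: filterS (filterI UX (Ug n)) => k /= [Xk ngk]; rewrite AX//.
have /ltW := Yg _ Xk; apply: le_trans; rewrite lee_fin lerB//.
by rewrite lef_pV2 ?posrE ?ltr0n// ler_nat ltnS.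
Qed.

(** On [B] the gap between the densities integrates to [e] times [P B]; on the rest of [D] almost
    inclusion along [U] keeps the masses in order. *)
Lemma le_ulim_measure_gap (M M' : nat -> malg P) D B (e : R) :
  measurable D -> measurable B -> B `<=` D ->
  (forall x, B x -> density UU M x + e <= density UU M' x) ->
  (\forall k \near U, P.-negligible (D `&` mrepr (M k) `\` mrepr (M' k))) ->
  (ulim_measure UU M D + e%:E * P B <= ulim_measure UU M' D)%E.
Proof.
move=> mD mB BD hB MM'.
have mDB : measurable (D `\` B) by exact: measurableD.
have split_mu (L : nat -> malg P) : (ulim_measure UU L D =
    ulim_measure UU L B + ulim_measure UU L (D `\` B))%E.
  by rewrite -ulim_measureU ?setDUK// setDIK.
rewrite !split_mu addeAC; apply: leeD; last first.
  apply: le_ulim_measure => //; apply: filterS MM' => k N.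
  apply: le_measure_negligibleD; do 2?[exact: measurable_mreprI].
  by apply: negligibleS N => x [[Mx [Dx Bx]] Nx]; split=> // M'x; apply: Nx.
rewrite -!integral_density// -integral_cst// -integralD//.
- apply: le_integral => //.
  + apply: integrableD => //.
      by apply: integrableS (integrable_density UU M).
    exact: finite_measure_integrable_cst.
  + by apply: integrableS (integrable_density UU M').
  + by move=> x /set_mem Bx; rewrite /= -EFinD lee_fin; exact: hB.
- by apply: integrableS (integrable_density UU M).
- exact: finite_measure_integrable_cst.
Qed.

(** Almost everywhere on [D] the densities of the [E n] decrease and stay above that of [A], so
    convergence fails only where a gap [1/(j+1)] persists for all [n], that is on [B j]. If [B j]
    were not null, every [E n] would exceed the mass of [A] on [D] by a fixed positive amount,
    against the last hypothesis. *)
Lemma density_cvg_pseudointersection (E : nat -> nat -> malg P)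
    (A : nat -> malg P) D : measurable D ->
  (forall n k, P.-negligible (D `&` mrepr (E n.+1 k) `\` mrepr (E n k))) ->
  (forall n, \forall k \near U,
    P.-negligible (D `&` mrepr (A k) `\` mrepr (E n k))) ->
  (forall a, (forall n, a%:E <= ulim_measure UU (E n) D)%E ->
    (a%:E <= ulim_measure UU A D)%E) ->
  P.-negligible (D `\` [set x |
    density UU (E n) x @[n --> \oo] --> density UU A x]).
Proof.
move=> mD decE AE massA.
pose B j := D `&` [set x | forall n : nat,
  density UU A x + j.+1%:R^-1 < density UU (E n) x].
have mB j : measurable (B j).
  apply: measurableI => //.
  apply: (@measurable_forall _ T nat) => n.
  rewrite -[X in measurable X]setTI.
  apply: (measurable_fun_ltr _ _ measurableT (Y := [set true])) => //.
    by apply: measurable_funD => //; exact: measurable_density.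
  exact: measurable_density.
have B0 j : P.-negligible (B j).
  have j0 : (0 : R) < j.+1%:R^-1 by rewrite invr_gt0 ltr0n.
  have [l lE _] := ulim_measure_cvg UU A mD.
  have PB : P (B j) \is a fin_num by exact: fin_num_measure.
  have : ((l + j.+1%:R^-1 * fine (P (B j)))%:E <= l%:E)%E.
    rewrite -lE; apply: massA => n; rewrite EFinD EFinM fineK// -lE.
    apply: le_ulim_measure_gap => //; first exact: subIsetl.
    by move=> x [_ /(_ n)/ltW].
  rewrite lee_fin gerDl pmulr_rle0// -lee_fin fineK// => PB0.
  by apply/negligibleP => //; apply/eqP; rewrite eq_le PB0 measure_ge0.
have Nle n : P.-negligible
    (D `\` [set x | density UU A x <= density UU (E n) x]).
  exact: negligible_density_le.
have Nmon n : P.-negligible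
    (D `\` [set x | density UU (E n.+1) x <= density UU (E n) x]).
  by apply: negligible_density_le => //; apply: nearW => k; exact: decE.
apply: negligibleS (negligibleU (negligible_bigcup B0)
  (negligibleU (negligible_bigcup Nle) (negligible_bigcup Nmon))).
move=> x [Dx ncv]; apply: contrapT => NN; apply: ncv => /=.
have le n : density UU A x <= density UU (E n) x.
  by apply: contrapT => h; apply: NN; right; left; exists n.
have mon n : density UU (E n.+1) x <= density UU (E n) x.
  by apply: contrapT => h; apply: NN; right; right; exists n.
have close j : exists n, density UU (E n) x <= density UU A x + j.+1%:R^-1.
  apply: contrapT => h; apply: NN; left; exists j => //; split=> // n.
  by rewrite ltNge; apply/negP => hn; apply: h; exists n.
have noninc : nonincreasing_seq (fun n => density UU (E n) x).
  exact/nonincreasing_seqP.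
apply/cvgrPdist_le => e e0; have [j] := ltr_add_invr e0; rewrite add0r => je.
have [n hn] := close j; exists n => // i /= ni.
rewrite distrC ger0_norm ?subr_ge0// lerBlDl.
apply: (le_trans (noninc _ _ ni)); apply: (le_trans hn).
by rewrite lerD2l ltW.
Qed.

End PProperty.

(** * Dedekind cuts and the Solovay measure in the extension *)

Section Cuts.
Variable R : realType.
Implicit Types (a b : R) (q : rat).

Lemma rat_cut_addP a b q : ratr q < a + b <->
  exists r s : rat, q = r + s /\ ratr r < a /\ ratr s < b.
Proof.
split=> [|[r [s [-> [ra sb]]]]]; last by rewrite rmorphD/= ltrD.
rewrite -ltrBlDl => /rat_in_itvoo[s]; rewrite in_itv/= => /andP[qs sb].
exists (q - s), s; rewrite subrK rmorphB/=; split=> //; split=> //.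
by rewrite ltrBlDr -ltrBlDl.
Qed.

Lemma rat_cut_openP a q :
  ratr q < a <-> exists r : rat, q < r /\ ratr r < a.
Proof.
split=> [/rat_in_itvoo[r]|[r [qr]]]; last by apply: lt_trans; rewrite ltr_rat.
by rewrite in_itv/= ltr_rat => /andP[qr ra]; exists r.
Qed.

Lemma rat_cut_inhabited a : exists q, ratr q < a.
Proof.
have /rat_in_itvoo[q] : a - 1 < a by rewrite ltrBlDr ltrDl.
by rewrite in_itv/= => /andP[_ qa]; exists q.
Qed.

Lemma rat_cut_bounded a : exists q, ~ ratr q < a.
Proof.
have /rat_in_itvoo[q] : a < a + 1 by rewrite ltrDl.
by rewrite in_itv/= => /andP[aq _]; exists q; apply/negP; rewrite -leNgt ltW.
Qed.

End Cuts.

(** * Pointwise interpretation of classes and of statements about cuts *)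

Section ClassValues.
Context d (T : measurableType d) (R : realType) (P : probability T R).

(* [V x] is the interpretation of [C] when the generic element is [x]. *)
Definition class_value (X : Type) (C : class (malg P) X)
    (V : T -> X -> Prop) :=
  forall i, truth_value (C i) [set x | V x i].

Lemma class_value_ground (X : Type) (A : set X) :
  class_value (cground A) (fun _ => A).
Proof. move=> i; exact: truth_value_ground. Qed.

Lemma class_value_name (X : Type) (A : name (malg P) X) :
  class_value A (fun x i => mrepr (A i) x).
Proof. move=> i; exact: truth_value_name. Qed.

Section Operations.
Variables (X : countType) (C D : class (malg P) X) (V W : T -> X -> Prop).
Hypotheses (CV : class_value C V) (DW : class_value D W).

Lemma truth_value_csub :
  truth_value (csub C D) [set x | forall i, V x i -> W x i].
Proof. exact: truth_value_forall (fun i => truth_value_imp (CV i) (DW i)). Qed.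

Lemma truth_value_ceq :
  truth_value (ceq C D) [set x | forall i, V x i <-> W x i].
Proof. exact: truth_value_forall (fun i => truth_value_iff (CV i) (DW i)). Qed.

Lemma class_value_union : class_value (cunion C D) (fun x i => V x i \/ W x i).
Proof. move=> i; exact: truth_value_or (CV i) (DW i). Qed.

Lemma class_value_inter : class_value (cinter C D) (fun x i => V x i /\ W x i).
Proof. move=> i; exact: truth_value_and (CV i) (DW i). Qed.

Lemma class_value_diff :
  class_value (cdiff C D) (fun x i => V x i /\ ~ W x i).
Proof. move=> i; exact: truth_value_and (CV i) (truth_value_not (DW i)). Qed.

End Operations.

Lemma truth_value_cfinite (X : countType) (C : class (malg P) X)
    (V : T -> X -> Prop) : class_value C V ->
  truth_value (cfinite C) [set x | finite_set (V x)].
Proof.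
move=> CV; apply: truth_value_ext.
  apply: truth_value_exists => s.
  exact: truth_value_ceq CV (class_value_ground [set i | i \in s]).
move=> x /=; split=> [[s Vs]|/finite_seqP[s Vs]].
  by apply/finite_seqP; exists s; apply/seteqP; split=> i /Vs.
by exists s => i; rewrite Vs.
Qed.

Lemma class_value_cut_add (C D : class (malg P) rat) (f g : T -> R) :
  class_value C (fun x q => ratr q < f x) ->
  class_value D (fun x q => ratr q < g x) ->
  class_value (cut_add C D) (fun x q => ratr q < f x + g x).
Proof.
move=> Cf Dg q; apply: truth_value_ext.
  exact: truth_value_exists (fun r => truth_value_exists (fun s =>
    truth_value_and (truth_value_ground P _)
      (truth_value_and (Cf r) (Dg s)))).
by move=> x; exact: iff_sym (rat_cut_addP _ _ _).
Qed.

Lemma class_value_rat_cut (c : rat) :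
  class_value (rat_cut c : class (malg P) rat)
    (fun _ q => ratr q < ratr c :> R).
Proof.
move=> q; apply: truth_value_ext; first exact: truth_value_ground.
by move=> x /=; rewrite ltr_rat.
Qed.

Lemma truth_value_cut_axioms (C : class (malg P) rat) (f : T -> R) :
  class_value C (fun x q => ratr q < f x) ->
  truth_value (cut_axioms C) setT.
Proof.
move=> Cf; apply: truth_value_ext.
  exact: truth_value_and (truth_value_exists Cf) (truth_value_and
    (truth_value_exists (fun q => truth_value_not (Cf q)))
    (truth_value_forall (fun q => truth_value_iff (Cf q)
      (truth_value_exists (fun r =>
        truth_value_and (truth_value_ground P (q < r)) (Cf r)))))).
move=> x; split=> // _; split; first exact: rat_cut_inhabited.
by split; [exact: rat_cut_bounded|move=> q; exact: rat_cut_openP].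
Qed.

Lemma truth_value_cut_le (C D : class (malg P) rat) (f g : T -> R) :
  class_value C (fun x q => ratr q < f x) ->
  class_value D (fun x q => ratr q < g x) ->
  truth_value (cut_le C D) [set x | f x <= g x].
Proof.
move=> Cf Dg; apply: truth_value_ext; first exact: truth_value_csub Cf Dg.
move=> x /=; split=> [fg|fg q]; last by move=> /lt_le_trans; exact.
rewrite leNgt; apply/negP => /rat_in_itvoo[q].
rewrite in_itv/= => /andP[gq qf].
by have := lt_trans gq (fg q qf); rewrite ltxx.
Qed.

Lemma truth_value_cut_eq (C D : class (malg P) rat) (f g : T -> R) :
  class_value C (fun x q => ratr q < f x) ->
  class_value D (fun x q => ratr q < g x) ->
  truth_value (ceq C D) [set x | f x = g x].
Proof.
move=> Cf Dg; apply: truth_value_ext; first exact: truth_value_ceq Cf Dg.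
move=> x /=; split=> [fg|->//].
apply/eqP; rewrite eq_le !leNgt; apply/andP; split; apply/negP;
  move=> /rat_in_itvoo[q]; rewrite in_itv/= => /andP[lo hi].
  by have /fg := hi; rewrite ltNge ltW.
by have /fg := hi; rewrite ltNge ltW.
Qed.

Lemma truth_value_cut_lim (C : nat -> class (malg P) rat)
    (D : class (malg P) rat) (f : nat -> T -> R) (g : T -> R) :
  (forall n, class_value (C n) (fun x q => ratr q < f n x)) ->
  class_value D (fun x q => ratr q < g x) ->
  truth_value (cut_lim C D) [set x | f n x @[n --> \oo] --> g x].
Proof.
move=> Cf Dg; apply: truth_value_ext.
  exact: truth_value_forall (fun e : rat =>
    truth_value_imp (truth_value_ground P (0 < e)) (truth_value_exists
    (fun N : nat => truth_value_forall (fun n : nat =>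
    truth_value_imp (truth_value_ground P (N <= n)%N) (truth_value_and
    (truth_value_cut_le (Cf n)
      (class_value_cut_add Dg (class_value_rat_cut e)))
    (truth_value_cut_le Dg
      (class_value_cut_add (Cf n) (class_value_rat_cut e)))))))).
move=> x /=; split=> [fg|/cvgrPdist_le fg e e0].
  (* Rational precisions suffice: the cut statement is used at a rational between 0 and the real
     [e]. *)
  apply/cvgrPdist_le => e e0; have [q] := rat_in_itvoo e0.
  rewrite in_itv/= ltr0q => /andP[q0 qe]; have [N NP] := fg q q0.
  exists N => // n /= Nn; have [h1 h2] := NP n Nn.
  apply: le_trans (ltW qe); rewrite ler_distlC.
  by rewrite h1 andbT lerBlDr.
have [|N _ NP] := fg (ratr e); first by rewrite ltr0q.
exists N => n Nn; have := NP n Nn.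
by rewrite /= ler_distlC lerBlDr => /andP[].
Qed.

End ClassValues.

(** * The clauses of being a P-measure, for the Solovay measure *)

Section SolovayMeasure.
Context d (T : measurableType d) (R : realType) (P : probability T R).
Context (U : set_system nat) (UU : UltraFilter U).
Local Notation mu := (solovay_measure P UU).

(** The name is built from the extended real derivative; its real-valued version differs on a null
    set only, which leaves Boolean values unchanged. *)
Lemma class_value_solovay_measure (A : name (malg P) nat) :
  class_value (mu A) (fun x q => ratr q < density UU A x).
Proof.
move=> q; have mA := measurable_ulim_density UU A.
have muAq : truth_value (cname (mu A) q)
    [set x | ((ratr q)%:E < ulim_density UU A x)%E].
  exact: truth_value_mclass.
apply: truth_value_ae muAq _ _.
  rewrite -[X in measurable X]setTI.
  apply: (measurable_fun_ltr _ _ measurableT (Y := [set true])) => //.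
  exact: measurable_density.
by apply: filterS (ae_ulim_density UU A) => x /= ->; rewrite lte_fin.
Qed.

Lemma solovay_measure_wd : forced (setfun_wd mu).
Proof.
move=> p _ A A'; apply: fimp_intro => q [q0 _].
have AV := class_value_name A; have A'V := class_value_name A'.
move=> /((truth_value_ceq AV A'V).2 q q0) AA'.
have muA := class_value_solovay_measure A.
have muA' := class_value_solovay_measure A'.
apply/((truth_value_cut_eq muA muA').2 q q0).
have mq := measurable_mrepr q.
have N1 : P.-negligible
    (mrepr q `\` [set x | density UU A x <= density UU A' x]).
  apply: negligible_density_le => //; apply: nearW => k.
  by apply: negligibleS AA' => x [[qx Ax] Nx]; split=> // /(_ k)[/(_ Ax)].
have N2 : P.-negligible
    (mrepr q `\` [set x | density UU A' x <= density UU A x]).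
  apply: negligible_density_le => //; apply: nearW => k.
  by apply: negligibleS AA' => x [[qx Ax] Nx]; split=> // /(_ k)[_ /(_ Ax)].
apply: negligibleS (negligibleU N1 N2) => x [qx /= /eqP].
by rewrite eq_le negb_and => /orP[/negP|/negP]; [left|right].
Qed.

Lemma solovay_measure_unit : forced (unit_valued mu).
Proof.
move=> p p0 A; have muA := class_value_solovay_measure A.
split; last split.
- by apply/((truth_value_cut_axioms muA).2 p p0); rewrite setDT;
    exact: negligible_set0.
- apply/((truth_value_cut_le (class_value_rat_cut P 0) muA).2 p p0).
  apply: negligibleS (negligible_set0 P) => x [_ /=].
  by rewrite rmorph0 density_ge0.
- apply/((truth_value_cut_le muA (class_value_rat_cut P 1)).2 p p0).
  apply: negligibleS (negligible_set0 P) => x [_ /=].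
  by rewrite rmorph1 density_le1.
Qed.

Lemma solovay_measure_additive : forced (finitely_additive mu).
Proof.
move=> p _ A A' C; apply: fimp_intro => q [q0 _].
have AV := class_value_name A; have A'V := class_value_name A'.
have CV := class_value_name C.
move=> /((truth_value_ceq (class_value_inter AV A'V)
  (class_value_ground P set0)).2 q q0) AA'0.
(* Disjointness is forced by [q] and the union by its extension [r]; densities are compared on
   [r]. *)
apply: fimp_intro => r qr; have [r0 _] := qr.
move=> /((truth_value_ceq CV (class_value_union AV A'V)).2 r r0) CAA'.
apply/((truth_value_cut_eq (class_value_solovay_measure C)
  (class_value_cut_add (class_value_solovay_measure A)
    (class_value_solovay_measure A'))).2 r r0).
apply: negligible_density_add; first exact: measurable_mrepr.
  move=> k; apply: negligibleS (negligible_extends qr AA'0).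
  by move=> x [rx AA'x]; split=> // /(_ k)[/(_ AA'x)].
by move=> k; apply: negligibleS CAA' => x [rx Nx]; split=> // /(_ k).
Qed.

Lemma solovay_measure_mass1 : forced (total_mass_one mu).
Proof.
move=> p _ A; apply: fimp_intro => q [q0 _].
move=> /((truth_value_ceq (class_value_name A)
  (class_value_ground P [set: nat])).2 q q0) AT.
apply/((truth_value_cut_eq (class_value_solovay_measure A)
  (class_value_rat_cut P 1)).2 q q0).
rewrite rmorph1; apply: negligible_density_eq1; first exact: measurable_mrepr.
by move=> k; apply: negligibleS AT => x [qx Nx]; split=> // /(_ k)[_ /(_ I)].
Qed.

Lemma solovay_measure_singletons :
  nonprincipal U -> forced (vanishes_on_singletons mu).
Proof.
move=> nU p _ n A; apply: fimp_intro => q [q0 _].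
move=> /((truth_value_ceq (class_value_name A)
  (class_value_ground P [set n])).2 q q0) An.
apply/((truth_value_cut_eq (class_value_solovay_measure A)
  (class_value_rat_cut P 0)).2 q q0).
rewrite rmorph0; apply: negligible_density_eq0; first exact: measurable_mrepr.
(* Past [n] the sets [A k] are null on the condition, and such [k] form a set in [U]. *)
apply: filterS (ultrafilter_tail UU n.+1 nU) => k /= nk.
apply: negligibleS An => x [qx Ax]; split=> // /(_ k)[/(_ Ax)] /= kn.
by rewrite kn ltnn in nk.
Qed.

(** The sequence is known to decrease only below [q], so the diagonal name is built on the
    representative of [q]; its almost everywhere properties then pass to all extensions, and one
    name serves them all. *)
Lemma solovay_measure_P_property : P_point U -> forced (P_property mu).
Proof.
move=> pU p _ E; apply: fimp_intro => q [q0 _] decE.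
apply: fimp_intro => r qr _.
have {}decE n k :
    P.-negligible (mrepr q `&` mrepr (E n.+1 k) `\` mrepr (E n k)).
  have /((truth_value_csub (class_value_name (E n.+1))
    (class_value_name (E n))).2 q q0) := decE n.
  by apply: negligibleS => x [[qx Ex] NEx]; split=> // /(_ k Ex).
have mq := measurable_mrepr q.
have [A [finA AE massA]] := P_point_pseudointersection UU pU mq decE.
apply: (fex_intro (i := A)) => s rs; have [s0 _] := rs.
split=> [n|].
  apply/((truth_value_cfinite (class_value_diff (class_value_name A)
    (class_value_name (E n)))).2 s s0).
  apply: negligibleS (negligible_extends rs (negligible_extends qr finA)).
  by move=> x [sx Nx]; split=> // /(_ n).
apply/((truth_value_cut_lim (fun n => class_value_solovay_measure (E n))
  (class_value_solovay_measure A)).2 s s0).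
apply: negligible_extends rs (negligible_extends qr _).
exact: density_cvg_pseudointersection.
Qed.

Lemma solovay_measure_P_measure : P_point U -> forced (P_measure mu).
Proof.
move=> pU p p0; have [_ nU _] := pU.
split; [split; last split; last split|split].
- exact: solovay_measure_wd.
- exact: solovay_measure_unit.
- exact: solovay_measure_additive.
- exact: solovay_measure_mass1.
- exact: solovay_measure_singletons.
- exact: solovay_measure_P_property.
Qed.

End SolovayMeasure.

Theorem theorem4p15 (R : realType) (K : choiceType)
    (K_infinite : infinite_set [set: K])
    (lambda : probability (borel2 K) R)
    (lambda_product : is_product_measure lambda)
    (U : set_system nat) (UU : UltraFilter U) (U_nonprincipal : nonprincipal U) :
  P_point U -> forced (P_measure (solovay_measure lambda UU)).
Proof. exact: solovay_measure_P_measure. Qed.
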